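(* Consider the following greedy algorithm for the Set Cover with Pairs problem: start with $S=\emptyset$; while not every target is covered, choose $P\subseteq V\setminus S$ with $|P|\le 2$ maximizing $$g(P)=\Big|\bigcup_{\{v_1,v_2\}\subseteq S\cup P} C(\{v_1,v_2\})\Big|-\Big|\bigcup_{\{v_1,v_2\}\subseteq S} C(\{v_1,v_2\})\Big|,$$ and replace $S$ by $S\cup P$; output $S$ once $\bigcup_{\{v_1,v_2\}\subseteq S}C(\{v_1,v_2\})=T$. This algorithm is an $O(\sqrt{n\log t})$-approximation algorithm for the Set Cover with Pairs problem.
   Context: Set Cover with Pairs (SCP) problem: let $T$ be a set of $t$ targets and $V$ a set of $n$ elements. For every pair of elements $P=\{v_1,v_2\}\subseteq V$, $C(P)\subseteq T$ denotes the set of targets covered by $P$. The problem asks for a smallest subset $S\subseteq V$ such that $\bigcup_{\{v_1,v_2\}\subseteq S} C(\{v_1,v_2\}) = T$. An $r$-approximation algorithm outputs a feasible solution of size at most $r$ times the optimum. *)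

(* Defs.v *)
From mathcomp Require Import all_boot all_order all_algebra.
From mathcomp Require Import reals exp.

Set Implicit Arguments.
Unset Strict Implicit.
Unset Printing Implicit Defensive.

Import Order.TTheory GRing.Theory Num.Theory.

(* An instance is a function C; only its values C [set v1; v2] are ever used.
   The case v1 = v2 is allowed; an instance in which only pairs of distinct
   elements cover targets is one with C [set v] = set0 for every v. *)

Definition covered (V T : finType) (C : {set V} -> {set T}) (S : {set V}) :
    {set T} :=
  \bigcup_(v1 in S) \bigcup_(v2 in S) C [set v1; v2].

Definition feasible (V T : finType) (C : {set V} -> {set T}) (S : {set V}) :
    Prop :=
  covered C S = [set: T].

Definition optimal (V T : finType) (C : {set V} -> {set T}) (S : {set V}) :
    Prop :=
  feasible C S /\ forall S' : {set V}, feasible C S' -> #|S| <= #|S'|.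

(* The subtraction is never truncated, since covered C is monotone. *)
Definition gain (V T : finType) (C : {set V} -> {set T}) (S P : {set V}) : nat :=
  #|covered C (S :|: P)| - #|covered C S|.

Definition candidate (V : finType) (S P : {set V}) : Prop :=
  P \subset ~: S /\ #|P| <= 2.

(* One iteration of the loop; ties between maximizers are broken arbitrarily,
   so this is a relation. *)
Definition greedy_step (V T : finType) (C : {set V} -> {set T})
    (S S' : {set V}) : Prop :=
  ~ feasible C S /\
  exists P : {set V},
    [/\ candidate S P,
        forall Q : {set V}, candidate S Q -> gain C S Q <= gain C S P
      & S' = S :|: P].

Inductive greedy_reachable (V T : finType) (C : {set V} -> {set T}) :
    {set V} -> Prop :=
| greedy_start : greedy_reachable C set0
| greedy_next (S S' : {set V}) :
    greedy_reachable C S -> greedy_step C S S' -> greedy_reachable C S'.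

Definition greedy_output (V T : finType) (C : {set V} -> {set T})
    (S : {set V}) : Prop :=
  greedy_reachable C S /\ feasible C S.

(* There is no infinite sequence of iterations from the empty set. *)
Definition greedy_terminates (V T : finType) (C : {set V} -> {set T}) : Prop :=
  Acc (fun S' S : {set V} => greedy_step C S S') set0.

Local Open Scope ring_scope.

(* The ratio r n t depends on the number n of elements and t of targets.
   Instances without any feasible solution are excluded. *)
Definition greedy_is_approximation (R : realType) (r : nat -> nat -> R) : Prop :=
  forall (V T : finType) (C : {set V} -> {set T}),
    (exists S : {set V}, feasible C S) ->
    [/\ greedy_terminates C,
        exists S : {set V}, greedy_output C S
      & forall S : {set V}, greedy_output C S ->
          feasible C S /\
          forall S' : {set V}, optimal C S' ->
            #|S|%:R <= r #|V| #|T| * #|S'|%:R].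

(* r(n, t) = O(sqrt(n log t)), with one constant for all n and all t >= 2.
   For t <= 1 the logarithm vanishes or is undefined. *)
Definition bigO_sqrt_n_log_t (R : realType) (r : nat -> nat -> R) : Prop :=
  exists2 c : R, 0 < c &
    forall n t : nat, (2 <= t)%N -> r n t <= c * Num.sqrt (n%:R * ln t%:R).

(* Main.v *)
Require Import Defs.
From mathcomp Require Import all_boot all_order all_algebra.
From mathcomp Require Import reals exp.
From mathcomp Require Import sequences lra.

Set Implicit Arguments.
Unset Strict Implicit.
Unset Printing Implicit Defensive.

Import Order.TTheory GRing.Theory Num.Theory.

(** Let [k] be the size of a feasible set [A]. Its [k ^ 2] ordered pairs cover
    all targets, so one of them covers at least a [1 / k ^ 2] fraction of the
    targets still uncovered, and the greedy choice does at least as well. After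
    [m] iterations at most [t * exp (- m / k ^ 2)] targets are left; hence there
    are at most [1 + k ^ 2 * ln t] iterations, and the output [S] satisfies
    [|S| <= 2 + 2 * k ^ 2 * ln t] besides [|S| <= n]. The first bound gives the
    ratio when [k * ln t <= sqrt (n * ln t)], the second one otherwise. *)

(** * Gain of a greedy step, and termination of the loop *)

Section Greedy.

Variables (V T : finType) (C : {set V} -> {set T}).

Implicit Types S P A : {set V}.

Local Notation uncovered S := (~: covered C S).

Lemma coveredS S1 S2 : S1 \subset S2 -> covered C S1 \subset covered C S2.
Proof.
move=> sS; apply/bigcupsP => v1 v1S; apply/bigcupsP => v2 v2S.
apply: (bigcup_max v1); first exact: (subsetP sS).
by apply: (bigcup_max v2); first exact: (subsetP sS).
Qed.

Lemma covered0 : covered C set0 = set0.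
Proof. by rewrite /covered big_set0. Qed.

Lemma card_uncovered_gt0 S : ~ feasible C S -> 0 < #|uncovered S|.
Proof.
move=> nfS; rewrite lt0n cards_eq0; apply/eqP => uS0; apply: nfS.
by rewrite /feasible -[covered C S]setCK uS0 setC0.
Qed.

Lemma card_uncoveredU S P :
  #|uncovered (S :|: P)| + gain C S P = #|uncovered S|.
Proof.
have leSP : #|covered C S| <= #|covered C (S :|: P)|.
  exact/subset_leq_card/coveredS/subsetUl.
have c1 := cardsC (covered C S); have c2 := cardsC (covered C (S :|: P)).
apply: (@addnI #|covered C S|).
by rewrite c1 addnCA /gain subnKC // addnC.
Qed.

Lemma gain_gt0_neq0 S P : 0 < gain C S P -> P != set0.
Proof. by apply: contraTneq => ->; rewrite /gain setU0 subnn. Qed.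

(** Removing [S] from the pair makes it a legal candidate and leaves its union with [S] unchanged,
    so nothing it newly covers is lost. *)
Lemma card_pair_le_gain S v1 v2 :
  #|C [set v1; v2] :\: covered C S| <= gain C S ([set v1; v2] :\: S).
Proof.
have leSP : #|covered C S| <= #|covered C (S :|: [set v1; v2] :\: S)|.
  exact/subset_leq_card/coveredS/subsetUl.
rewrite /gain leq_subRL //.
have -> : S :|: [set v1; v2] :\: S = S :|: [set v1; v2].
  by apply/setP => x; rewrite !inE; case: (x \in S).
rewrite -(cardsID (covered C S) (covered C (S :|: _))).
apply: leq_add; apply: subset_leq_card.
  by rewrite subsetI subxx andbT; apply/coveredS/subsetUl.
apply: setSD; apply: (bigcup_max v1); first by rewrite !inE eqxx orbT.
by apply: (bigcup_max v2); first by rewrite !inE eqxx !orbT.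
Qed.

Lemma candidate_pair S v1 v2 : candidate S ([set v1; v2] :\: S).
Proof.
split; first by rewrite setDE subsetIr.
apply: leq_trans (subset_leq_card (subsetDl _ _)) _.
by rewrite cards2; case: (_ == _).
Qed.

(** Each uncovered target lies in [C [set v1; v2]] for some ordered pair from [A], possibly with
    [v1 = v2]; the rest is a union bound. *)
Lemma card_uncovered_le_sum A S : feasible C A ->
  #|uncovered S| <= \sum_(v1 in A) \sum_(v2 in A) gain C S ([set v1; v2] :\: S).
Proof.
move=> fA.
pose F v1 v2 := C [set v1; v2] :\: covered C S.
apply: (@leq_trans (\sum_(v1 in A) \sum_(v2 in A) #|F v1 v2|)); last first.
  by do 2!apply: leq_sum => ? _; apply: card_pair_le_gain.
have -> : uncovered S = \bigcup_(v1 in A) \bigcup_(v2 in A) F v1 v2.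
  apply/setP => x; rewrite inE; apply/idP/bigcupP => [xS|[v1 v1A]].
    have /bigcupP[v1 v1A /bigcupP[v2 v2A xC]] : x \in covered C A.
      by rewrite fA inE.
    by exists v1 => //; apply/bigcupP; exists v2; rewrite // inE xS.
  by case/bigcupP => v2 v2A; rewrite inE => /andP[].
have cardU (F' : V -> {set T}) :
    #|\bigcup_(v in A) F' v| <= \sum_(v in A) #|F' v|.
  elim/big_rec2: _ => [|v n B _ leB]; first by rewrite cards0.
  by apply: leq_trans (leq_card_setU _ _) _; rewrite leq_add2l.
by apply: leq_trans (cardU _) _; apply: leq_sum => v _; apply: cardU.
Qed.

Lemma card_uncovered_le_gain A S P : feasible C A ->
  (forall Q, candidate S Q -> gain C S Q <= gain C S P) ->
  #|uncovered S| <= #|A| ^ 2 * gain C S P.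
Proof.
move=> fA maxP; apply: leq_trans (card_uncovered_le_sum S fA) _.
rewrite expnS expn1 -mulnA -sum_nat_const; apply: leq_sum => v1 _.
rewrite -sum_nat_const; apply: leq_sum => v2 _.
exact/maxP/candidate_pair.
Qed.

(** Some target is still uncovered, so the best gain is positive; hence [P] is nonempty, and it is
    disjoint from [S]. *)
Lemma greedy_step_proper A S S' : feasible C A -> greedy_step C S S' ->
  S \proper S'.
Proof.
move=> fA [nfS [P [[PS _] maxP ->]]].
have := leq_trans (card_uncovered_gt0 nfS) (card_uncovered_le_gain fA maxP).
rewrite muln_gt0 => /andP[_ /gain_gt0_neq0/set0Pn[x xP]].
apply/properP; split; first exact: subsetUl.
exists x; first by rewrite inE xP orbT.
by have := subsetP PS x xP; rewrite inE.
Qed.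

Lemma greedy_terminates_feasible A : feasible C A -> greedy_terminates C.
Proof.
(* Accessibility is proved from every starting set, by induction on the size of the complement. *)
move=> fA; rewrite /greedy_terminates; move: set0 => S.
have [n ltSn] := ubnP #|~: S|.
elim: n S ltSn => [S|n IHn S leSn]; first by rewrite ltn0.
apply: Acc_intro => S' stepS; apply: IHn.
rewrite -ltnS; apply: leq_trans leSn; rewrite ltnS.
by apply: proper_card; rewrite properC; apply: greedy_step_proper fA stepS.
Qed.

Lemma greedy_step_exists S : ~ feasible C S -> exists S', greedy_step C S S'.
Proof.
move=> nfS.
pose cand (P : {set V}) := (P \subset ~: S) && (#|P| <= 2).
have cand0 : cand set0 by rewrite /cand sub0set cards0.
case: (arg_maxnP (gain C S) cand0) => P /andP[PS P2] maxP.
exists (S :|: P); split=> //; exists P; split=> // Q [QS Q2].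
by apply: maxP; apply/andP.
Qed.

Lemma greedy_output_exists : greedy_terminates C ->
  exists S, greedy_output C S.
Proof.
rewrite /greedy_terminates => acc0; have := greedy_start C.
elim: acc0 => S _ IHS rS.
have [/eqP fS|/eqP nfS] := boolP (covered C S == setT); first by exists S.
have [S' stepS] := greedy_step_exists nfS.
exact: IHS stepS (greedy_next rS stepS).
Qed.

End Greedy.

Local Open Scope ring_scope.

(** * Logarithmic estimates and the ratio *)

Section Ratio.

Variable R : realType.

(** The inequality [1 + x <= expR x] at [x = - (1 / 2)] gives [expR (1 / 2) <= 2]. *)
Lemma half_le_ln2 : 1 / 2 <= ln 2%:R :> R.
Proof.
rewrite -ler_expR lnK ?posrE ?ltr0n //.
have := expR_ge1Dx (- (1 / 2) : R).
rewrite expRN => h; have e0 := expR_gt0 (1 / 2 : R).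
have : (1 - 1 / 2) * expR (1 / 2) <= (1 : R).
  by rewrite -ler_pdivlMr // [leRHS]mul1r.
lra.
Qed.

Lemma ln_ge_half (t : nat) : (2 <= t)%N -> 1 / 2 <= ln t%:R :> R.
Proof.
move=> t2; apply: le_trans half_le_ln2 _.
by rewrite ler_ln ?posrE ?ltr0n ?ler_nat // (leq_trans _ t2).
Qed.

Lemma greedy_reachable_card (V T : finType) (C : {set V} -> {set T})
    (A S : {set V}) :
  feasible C A -> (0 < #|T|)%N -> (0 < #|A|)%N -> greedy_reachable C S ->
  #|S|%:R <= 2 + 2 * (#|A|%:R ^+ 2 * ln #|T|%:R) :> R.
Proof.
move=> fA T0 A0 rS; set K : R := #|A|%:R ^+ 2; set t : R := #|T|%:R.
have K0 : 0 < K by rewrite exprn_gt0 // ltr0n.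
have t0 : 0 < t by rewrite ltr0n.
have lt0 : 0 <= ln t by rewrite ln_ge0 // ler1n.
(* Loop invariant, with [m] the number of iterations made so far. *)
suff [m [Sm _ mK]] : exists m : nat, [/\ (#|S| <= 2 * m)%N,
    #|~: covered C S|%:R <= t * expR (- (m%:R / K)) & m%:R <= 1 + K * ln t].
  have : #|S|%:R <= (2 * m)%:R :> R by rewrite ler_nat.
  rewrite natrM; lra.
elim: rS => [|{}S S' _ [m [Sm um mK]] [nfS [P [[_ P2] maxP ->]]]].
  exists 0%N; split; first by rewrite cards0.
    by rewrite covered0 setC0 cardsT mul0r oppr0 expR0 mulr1.
  by rewrite addr_ge0 // mulr_ge0 // ltW.
exists m.+1; split.
- by apply: leq_trans (leq_card_setU _ _) _; rewrite mulnS addnC leq_add.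
- have gP := card_uncovered_le_gain fA maxP.
  have gE := card_uncoveredU C S P.
  set u' := #|~: covered C (S :|: P)| in gE *.
  set u := #|~: covered C S| in um gP gE; set g := gain C S P in gP gE.
  have {}gP : u%:R <= K * g%:R :> R by rewrite /K -natrX -natrM ler_nat.
  have {}gE : u'%:R + g%:R = u%:R :> R by rewrite -natrD gE.
  have guK : u%:R / K <= g%:R by rewrite ler_pdivrMr // mulrC.
  have -> : - (m.+1%:R / K) = - (m%:R / K) + - K^-1.
    by rewrite -natr1 mulrDl mul1r opprD.
  rewrite expRD mulrA.
  (* A gain of at least [u / K] leaves at most [u * (1 - 1 / K) <= u * expR (- 1 / K)] targets. *)
  apply: le_trans (_ : u%:R * expR (- K^-1) <= _); last first.
    by rewrite ler_wpM2r // expR_ge0.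
  apply: le_trans (_ : u%:R * (1 + - K^-1) <= _); last first.
    by rewrite ler_wpM2l // expR_ge1Dx.
  rewrite mulrDr mulr1 mulrN; lra.
(* Before this iteration a target was uncovered, so [1 <= t * expR (- (m / K))], that is
   [m <= K * ln t]; the iteration itself adds 1. *)
- rewrite -natr1 addrC lerD2l.
  have u1 : 1 <= #|~: covered C S|%:R :> R.
    by rewrite ler1n; apply: card_uncovered_gt0.
  have := le_trans u1 um; rewrite expRN -ler_pdivrMr ?invr_gt0 ?expR_gt0 //.
  rewrite mul1r invrK => h; rewrite mulrC -ler_pdivrMr //.
  by rewrite -ler_expR lnK.
Qed.

Lemma min_bound_sqrt (s k n L : R) : 1 <= k -> 1 / 2 <= L -> 0 <= n ->
  s <= n -> s <= 2 + 2 * (k ^+ 2 * L) -> s <= 6 * Num.sqrt (n * L) * k.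
Proof.
move=> k1 L2 n0 sn skL.
have nL0 : 0 <= n * L by rewrite mulr_ge0 //; lra.
have q0 := sqrtr_ge0 (n * L); have q2 := sqr_sqrtr nL0.
move: q0 q2; set q := Num.sqrt _ => q0 q2.
have k0 : 0 <= k by lra.
have [kLq|qkL] := leP (k * L) q.
  (* The constant 6 arises here: [2 <= 4 * q <= 4 * (k * q)] and
     [2 * (k ^+ 2 * L) <= 2 * (k * q)]. *)
  have h1 : k * (k * L) <= k * q by apply: ler_wpM2l.
  have h2 : 1 / 2 <= q by apply: le_trans kLq; nra.
  have h3 : q <= k * q by rewrite ler_peMl.
  nra.
have L0 : 0 < L by lra.
(* Since [n * L = q * q] and [q < k * L], cancelling [L] yields [n <= k * q]. *)
have h : n * L <= (k * q) * L.
  rewrite -q2 expr2 mulrAC; apply: ler_wpM2r => //; exact: ltW.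
rewrite ler_pM2r // in h.
have : 0 <= k * q by rewrite mulr_ge0.
nra.
Qed.

End Ratio.

Theorem theorem5 (R : realType) :
  exists r : nat -> nat -> R,
    greedy_is_approximation r /\ bigO_sqrt_n_log_t r.
Proof.
(* For [t <= 1] the asymptotic bound demands nothing, and the trivial ratio [n] suffices. *)
exists (fun n t => if (2 <= t)%N then 6 * Num.sqrt (n%:R * ln t%:R) else n%:R).
split; last by exists 6 => [|n t ->]; rewrite ?ltr0n.
move=> V T C [A fA]; have term := greedy_terminates_feasible fA.
split=> //; first exact: greedy_output_exists.
move=> S [rS fS]; split=> // B [fB _].
(* An empty optimum forces [T] to be empty; then every set is feasible, no step is possible, and the
   output is empty too. *)
have [B0|B0] := posnP #|B|.
  move: fB; rewrite (cards0_eq B0) /feasible covered0 => T0.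
  have allf X : feasible C X.
    by apply/setP => x; have := in_setT x; rewrite -T0 inE.
  by case: rS => [|X X' _ [/(_ (allf X))]]; rewrite // !cards0 mulr0.
have B1 : 1 <= #|B|%:R :> R by rewrite ler1n.
have [T2|_] := leqP 2 #|T|; last first.
  by apply: le_trans (_ : #|V|%:R <= _); rewrite ?ler_nat ?max_card ?ler_peMr.
apply: min_bound_sqrt => //; first exact: ln_ge_half.
  by rewrite ler_nat max_card.
by apply: greedy_reachable_card rS => //; apply: ltnW.
Qed.
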